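(* Let $f:\mathbb R\to\mathbb R$ be $C^2$ and strictly convex with $f(0)=f'(0)=0$. Let $0\le u_0<u_1$. For $\varepsilon\in(0,1]$ let $\hat u^\varepsilon$ be the unique solution of $$\varepsilon \hat u^\varepsilon_{xx}=(f(\hat u^\varepsilon))_x\ \ (0<x<1),\qquad \hat u^\varepsilon(0)=u_0,\quad \hat u^\varepsilon(1)=u_1,$$ and let $v$ be the unique solution on $\mathbb R^+=[0,+\infty)$ of $$v''=-(f(u_0+v))',\qquad v(0)=u_1-u_0,\qquad v(+\infty)=0.$$ Then there is a constant $C>0$, independent of $\varepsilon\in(0,1]$, such that for all $x\in[0,1]$: if $u_0>0$, $$\Big|\hat u^\varepsilon(x)-u_0-v\Big(\tfrac{1-x}{\varepsilon}\Big)\Big|\le C e^{-f'(u_0)/\varepsilon},$$ whereas if $u_0=0$ and $f''(0)\neq0$, $$\Big|\hat u^\varepsilon(x)-v\Big(\tfrac{1-x}{\varepsilon}\Big)\Big|\le C\varepsilon .$$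
   Context: For every $\varepsilon>0$ and $u_0,u_1\in\mathbb R$ the boundary value problem for $\hat u^\varepsilon$ has a unique solution. *)

(* Defs.v *)
From Stdlib Require Export Reals.
From Coquelicot Require Export Coquelicot.
Open Scope R_scope.

Definition twice_derivable_at (g : R -> R) (x : R) : Prop :=
  ex_derive g x /\ ex_derive (Derive g) x.

Definition class_C2 (f : R -> R) : Prop :=
  forall x : R, twice_derivable_at f x /\ continuous (Derive_n f 2) x.

Definition strictly_convex (f : R -> R) : Prop :=
  forall x y t : R, x <> y -> 0 < t < 1 ->
    f (t * x + (1 - t) * y) < t * f x + (1 - t) * f y.

(* Classical solutions: the equation holds on the open interval and the
   function is continuous up to the boundary, where its data are prescribed.
   Since functions are total on R, values outside the domain are irrelevant:
   [continuous_on] uses the relative topology of the closed domain. *)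
Definition viscous_bvp_solution
    (f : R -> R) (eps u0 u1 : R) (u : R -> R) : Prop :=
  continuous_on (fun x => 0 <= x <= 1) u /\
  (forall x : R, 0 < x < 1 ->
     twice_derivable_at u x /\
     eps * Derive_n u 2 x = Derive (fun y => f (u y)) x) /\
  u 0 = u0 /\ u 1 = u1.

Definition layer_solution (f : R -> R) (u0 u1 : R) (v : R -> R) : Prop :=
  continuous_on (fun y => 0 <= y) v /\
  (forall y : R, 0 < y ->
     twice_derivable_at v y /\
     Derive_n v 2 y = - Derive (fun z => f (u0 + v z)) y) /\
  v 0 = u1 - u0 /\ is_lim v p_infty 0.

(* Main.v *)
Require Import Defs.
From Stdlib Require Import Reals Lra Psatz.
From Coquelicot Require Import Coquelicot.
Open Scope R_scope.

(** Integrating both equations once and reading [uh eps] in the variable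
    [y = (1 - x) / eps] turns them into [W' = f u0 - d - f W] on [0, 1/eps] and
    [V' = f u0 - f V], where [V = u0 + v], both starting at [u1]; the defect
    [d] is positive because a profile meeting an equilibrium is constant.
    Comparison gives [0 <= V - W], [V - W <= d * y], and, by convexity,
    [f' u0 * (V - W) <= d].  The defect is tied to the length [1/eps] needed by
    [W] to travel from [u1] to [u0]: if [f' u0 > 0] then [f] lies above its
    tangent and [d] is of order [exp (- f' u0 / eps)]; if [u0 = 0] and
    [f'' 0 > 0] then [f u >= k u^2] and [d] is of order [eps^2]. *)

(** * One-variable calculus: monotonicity, sign comparison and Gronwall *)

(** The hypotheses fit the profiles studied below: extended past the ends of their interval, they
    are continuous everywhere, while a derivative is known only inside. *)
Lemma mean_value_open (h dh : R -> R) (a b : R) :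
  a < b -> (forall x, continuous h x) ->
  (forall x, a < x < b -> is_derive h x (dh x)) ->
  exists c, a < c < b /\ h b - h a = dh c * (b - a).
Proof.
  intros Hab Hc Hd.
  assert (pr : forall c, a < c < b -> derivable_pt h c).
  { intros c H; exists (dh c); apply is_derive_Reals, Hd, H. }
  destruct (MVT h id a b pr (fun c _ => derivable_pt_id c) Hab) as [c [P E]].
  - intros c _; apply continuity_pt_filterlim, Hc.
  - intros c _; apply derivable_continuous_pt, derivable_pt_id.
  - exists c; split; [exact P|].
    rewrite derive_pt_id in E; unfold id in E.
    rewrite (derive_pt_eq_0 h c (dh c)) in E; [lra|].
    apply is_derive_Reals, Hd, P.
Qed.

Lemma nonincreasing_of_derive (h dh : R -> R) (a b : R) :
  a <= b -> (forall x, continuous h x) ->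
  (forall x, a < x < b -> is_derive h x (dh x)) ->
  (forall x, a < x < b -> dh x <= 0) -> h b <= h a.
Proof.
  intros [Hab | <-] Hc Hd Hn; [|lra].
  destruct (mean_value_open h dh a b Hab Hc Hd) as [c [P E]].
  specialize (Hn c P); nra.
Qed.

Lemma continuous_of_is_derive (h : R -> R) (x l : R) :
  is_derive h x l -> continuous h x.
Proof. intros H; apply (ex_derive_continuous h x); exists l; exact H. Qed.

Lemma null_derive_eq (h : R -> R) (p q : R) :
  (forall x, Rmin p q <= x <= Rmax p q -> is_derive h x 0) -> h p = h q.
Proof.
  intros H.
  destruct (MVT_gen h p q (fun _ => 0)) as [c [_ E]].
  - intros x Hx; apply H; lra.
  - intros x Hx; apply continuity_pt_filterlim.
    apply (continuous_of_is_derive h x 0), H, Hx.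
  - lra.
Qed.

Lemma positive_of_nonvanishing (h : R -> R) (T c : R) :
  (forall x, continuous h x) -> (forall x, 0 <= x <= T -> h x <> 0) ->
  0 <= c <= T -> 0 < h c -> forall x, 0 <= x <= T -> 0 < h x.
Proof.
  intros Hc Hn Hcr Hp x Hx.
  destruct (Rlt_le_dec 0 (h x)) as [|Hle]; [assumption|exfalso].
  destruct (IVT_gen h x c 0) as [z [Hz E]].
  - intros y; apply continuity_pt_filterlim, Hc.
  - rewrite Rmin_left, Rmax_right; lra.
  - apply (Hn z); [|exact E].
    revert Hz; unfold Rmin, Rmax; destruct (Rle_dec x c); lra.
Qed.

Lemma is_derive_sqr_pos_part (s : R) :
  is_derive (fun s => (Rmax s 0) ^ 2) s (2 * Rmax s 0).
Proof.
  apply is_derive_Reals; intros eta Heta.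
  exists (mkposreal eta Heta); intros h Hh0 Hh; simpl in Hh.
  (* The increment is squeezed: the remainder is at most [h ^ 2]. *)
  assert (B : Rabs ((Rmax (s + h) 0) ^ 2 - (Rmax s 0) ^ 2 - 2 * Rmax s 0 * h)
              <= Rabs h * Rabs h).
  { rewrite <- Rabs_mult, (Rabs_right (h * h)) by nra.
    unfold Rmax; destruct (Rle_dec (s + h) 0), (Rle_dec s 0);
      apply Rabs_le; split; nra. }
  replace ((Rmax (s + h) 0 ^ 2 - Rmax s 0 ^ 2) / h - 2 * Rmax s 0)
    with ((Rmax (s + h) 0 ^ 2 - Rmax s 0 ^ 2 - 2 * Rmax s 0 * h) / h)
    by (field; exact Hh0).
  unfold Rdiv; rewrite Rabs_mult, Rabs_inv.
  assert (P := Rabs_pos_lt h Hh0).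
  apply Rle_lt_trans with (2 := Hh).
  apply Rmult_le_reg_r with (1 := P).
  rewrite Rmult_assoc, Rinv_l, Rmult_1_r by lra; exact B.
Qed.

(* Monotonicity is applied to the square of the positive part of [E], which
   is differentiable wherever [E] is. *)
Lemma nonpositive_of_derive (E dE : R -> R) (T : R) :
  (forall x, continuous E x) ->
  (forall x, 0 < x < T -> is_derive E x (dE x)) ->
  E 0 <= 0 -> (forall x, 0 < x < T -> 0 < E x -> dE x <= 0) ->
  forall x, 0 <= x <= T -> E x <= 0.
Proof.
  intros Hc Hd H0 Hn x Hx.
  assert (K : (Rmax (E x) 0) ^ 2 <= (Rmax (E 0) 0) ^ 2).
  { apply (nonincreasing_of_derive (fun y => (Rmax (E y) 0) ^ 2)
             (fun y => dE y * (2 * Rmax (E y) 0))); [lra| | |].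
    - intros y; apply (continuous_comp E (fun s => (Rmax s 0) ^ 2)); [apply Hc|].
      eapply continuous_of_is_derive, is_derive_sqr_pos_part.
    - intros y Hy; apply (is_derive_comp (fun s => (Rmax s 0) ^ 2) E).
      + apply is_derive_sqr_pos_part.
      + apply Hd; lra.
    - intros y Hy; unfold Rmax; destruct (Rle_dec (E y) 0); [lra|].
      assert (dE y <= 0) by (apply Hn; lra); nra. }
  rewrite (Rmax_right (E 0)) in K by lra.
  revert K; unfold Rmax; destruct (Rle_dec (E x) 0); nra.
Qed.

(** On [[0, T]], [g exp(-K x)] is nonincreasing and [g exp(K x)] is nondecreasing; the first carries
    the zero at [c] to the right, the second to the left. *)
Lemma gronwall_zero (g dg : R -> R) (T K c : R) :
  (forall x, continuous g x) -> (forall x, 0 < x < T -> is_derive g x (dg x)) ->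
  (forall x, 0 <= g x) -> (forall x, 0 < x < T -> Rabs (dg x) <= K * g x) ->
  0 <= c <= T -> g c = 0 -> forall x, 0 <= x <= T -> g x = 0.
Proof.
  intros Hc Hd Hp HK Hcr H0 x Hx.
  assert (Hexp : forall k y, is_derive (fun y => exp (k * y)) y (k * exp (k * y))).
  { intros k y; auto_derive; [exact I|ring]. }
  assert (Hcm : forall k y, continuous (fun y => g y * exp (k * y)) y).
  { intros k y; apply (continuous_mult g (fun y => exp (k * y))); [apply Hc|].
    eapply continuous_of_is_derive, Hexp. }
  assert (Hdm : forall k y, 0 < y < T ->
    is_derive (fun y => g y * exp (k * y)) y ((dg y + k * g y) * exp (k * y))).
  { intros k y Hy.
    replace ((dg y + k * g y) * exp (k * y))
      with (dg y * exp (k * y) + g y * (k * exp (k * y))) by ring.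
    apply (is_derive_mult g (fun y => exp (k * y)));
      [apply Hd, Hy|apply Hexp|intros; apply Rmult_comm]. }
  apply Rle_antisym; [|apply Hp].
  destruct (Rle_dec c x) as [L|L].
  - assert (E : g x * exp (- K * x) <= g c * exp (- K * c)).
    { apply (nonincreasing_of_derive _
               (fun y => (dg y + - K * g y) * exp (- K * y)) c x L (Hcm (- K))).
      - intros y Hy; apply Hdm; lra.
      - intros y Hy; assert (HK' := HK y ltac:(lra)).
        apply Rabs_le_between in HK'; assert (E := exp_pos (- K * y)); nra. }
    assert (P := exp_pos (- K * x)); rewrite H0 in E; nra.
  - assert (E : - (g c * exp (K * c)) <= - (g x * exp (K * x))).
    { apply (nonincreasing_of_derive (fun y => - (g y * exp (K * y)))
               (fun y => - ((dg y + K * g y) * exp (K * y)))); [lra| | |].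
      - intros y; apply (continuous_opp (fun y => g y * exp (K * y))), Hcm.
      - intros y Hy; apply (is_derive_opp (fun y => g y * exp (K * y))), Hdm; lra.
      - intros y Hy; assert (HK' := HK y ltac:(lra)).
        apply Rabs_le_between in HK'; assert (E := exp_pos (K * y)); nra. }
    assert (P := exp_pos (K * x)); rewrite H0 in E; nra.
Qed.

(** * Convexity of the flux: tangents, slopes and Lipschitz bounds *)

(** If [f y] lay below the tangent at [x] by [eta > 0], convexity would put the graph at
    [x + t (y - x)] below that tangent by more than [t * eta], whereas differentiability allows at
    most half of this for small [t]. *)
Lemma convex_tangent_le (f : R -> R) (x y : R) :
  ex_derive f x -> strictly_convex f -> f x + Derive f x * (y - x) <= f y.
Proof.
  intros Hd Hcv.
  destruct (Req_dec x y) as [<-|Hne]; [lra|].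
  apply Rnot_lt_le; intros Hlt.
  set (eta := f x + Derive f x * (y - x) - f y) in *.
  set (m := Rabs (y - x)).
  assert (Hm : 0 < m) by (apply Rabs_pos_lt; lra).
  (* With this tolerance the remainder over an increment of length [t * m] is at most
     [t * eta / 2]. *)
  assert (Heta : 0 < eta / (2 * m)) by (apply Rdiv_lt_0_compat; unfold eta; lra).
  assert (D : derivable_pt_lim f x (Derive f x))
    by (apply is_derive_Reals, Derive_correct, Hd).
  destruct (D _ Heta) as [[d Hd0] Hlim]; simpl in Hlim.
  (* The first bound keeps [t] below 1, the second keeps the increment [t * m] below the radius
     [d]. *)
  set (t := Rmin (1/2) (d / (2 * m))).
  assert (Hdm : 0 < d / (2 * m)) by (apply Rdiv_lt_0_compat; lra).
  assert (Ht : 0 < t < 1).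
  { split; [apply Rmin_pos; lra|].
    apply Rle_lt_trans with (1/2); [apply Rmin_l|lra]. }
  assert (Ht2 : t * m < d).
  { apply Rle_lt_trans with (d / (2 * m) * m).
    - apply Rmult_le_compat_r; [lra|apply Rmin_r].
    - replace (d / (2 * m) * m) with (d / 2) by (field; lra); lra. }
  assert (Hh0 : t * (y - x) <> 0) by (apply Rmult_integral_contrapositive; lra).
  assert (Hh : Rabs (t * (y - x)) = t * m)
    by (rewrite Rabs_mult, (Rabs_right t) by lra; reflexivity).
  specialize (Hlim (t * (y - x)) Hh0 ltac:(lra)).
  assert (S := Hcv y x t ltac:(lra) Ht).
  replace (t * y + (1 - t) * x) with (x + t * (y - x)) in S by ring.
  assert (Q : Rabs (f (x + t * (y - x)) - f x - Derive f x * (t * (y - x)))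
              <= eta / 2 * t).
  { replace (f (x + t * (y - x)) - f x - Derive f x * (t * (y - x)))
      with (((f (x + t * (y - x)) - f x) / (t * (y - x)) - Derive f x)
              * (t * (y - x))) by (field; lra).
    rewrite Rabs_mult, Hh.
    replace (eta / 2 * t) with (eta / (2 * m) * (t * m)) by (field; lra).
    apply Rmult_le_compat_r; [nra|lra]. }
  apply Rabs_le_between in Q.
  assert (0 < eta) by (unfold eta; lra).
  assert (t * eta = t * (f x + Derive f x * (y - x) - f y)) by reflexivity.
  nra.
Qed.

Section convex_flux.

Variable f : R -> R.
Hypothesis hder : forall x, ex_derive f x.
Hypothesis hconv : strictly_convex f.

Lemma flux_continuous x : continuous f x.
Proof. apply (ex_derive_continuous f x), hder. Qed.

Lemma derive_flux_le x y : x <= y -> Derive f x <= Derive f y.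
Proof.
  intros [H | <-]; [|lra].
  assert (A := convex_tangent_le f x y (hder x) hconv).
  assert (B := convex_tangent_le f y x (hder y) hconv).
  nra.
Qed.

(** Slopes on [[-M, M]] lie between those at the two ends; the tangent inequalities at [x] and at
    [y] turn this into a bound on the increment. *)
Lemma flux_lipschitz M x y :
  Rabs x <= M -> Rabs y <= M ->
  Rabs (f x - f y)
    <= (Rabs (Derive f M) + Rabs (Derive f (- M))) * Rabs (x - y).
Proof.
  intros Hx Hy; apply Rabs_le_between in Hx, Hy.
  assert (A := convex_tangent_le f x y (hder x) hconv).
  assert (B := convex_tangent_le f y x (hder y) hconv).
  assert (Hb : forall z, - M <= z <= M ->
    - (Rabs (Derive f M) + Rabs (Derive f (- M))) <= Derive f z
      <= Rabs (Derive f M) + Rabs (Derive f (- M))).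
  { intros z Hz.
    assert (L := derive_flux_le (- M) z ltac:(lra)).
    assert (U := derive_flux_le z M ltac:(lra)).
    revert L U; unfold Rabs; destruct (Rcase_abs (Derive f M)),
      (Rcase_abs (Derive f (- M))); lra. }
  assert (Bx := Hb x Hx); assert (By := Hb y Hy).
  set (K := Rabs (Derive f M) + Rabs (Derive f (- M))) in *; clearbody K.
  apply Rabs_le; unfold Rabs; destruct (Rcase_abs (x - y)); split; nra.
Qed.

(** * The first-order profile equations: uniqueness and comparison *)

(** [(W - W c)^2] vanishes at [c], and its derivative is at most [2 * K] times itself in absolute
    value, [K] being a Lipschitz constant of [f] on a bounded interval containing the values of [W];
    Gronwall applies. *)
Lemma equilibrium_unique (W : R -> R) (A T c : R) :
  (forall x, continuous W x) ->
  (forall x, 0 < x < T -> is_derive W x (A - f (W x))) ->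
  0 <= c <= T -> f (W c) = A -> forall x, 0 <= x <= T -> W x = W c.
Proof.
  intros Hc Hd Hcr HA.
  assert (HT : 0 <= T) by lra.
  assert (Hc' : forall z, 0 <= z <= T -> continuity_pt W z)
    by (intros; apply continuity_pt_filterlim, Hc).
  destruct (continuity_ab_maj W 0 T HT Hc') as [p [Hp _]].
  destruct (continuity_ab_min W 0 T HT Hc') as [q [Hq _]].
  set (M := Rabs (W p) + Rabs (W q)).
  assert (HM : forall z, 0 <= z <= T -> Rabs (W z) <= M).
  { intros z Hz; specialize (Hp z Hz); specialize (Hq z Hz).
    unfold M; apply Rabs_le; revert Hp Hq; unfold Rabs.
    destruct (Rcase_abs (W p)), (Rcase_abs (W q)); lra. }
  set (K := Rabs (Derive f M) + Rabs (Derive f (- M))).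
  intros x Hx.
  assert (G : (W x - W c) ^ 2 = 0).
  { apply (gronwall_zero (fun y => (W y - W c) ^ 2)
             (fun y => 2 * (W y - W c) * (A - f (W y))) T (2 * K) c); auto.
    - intros y; apply (continuous_comp W (fun s => (s - W c) ^ 2)); [apply Hc|].
      apply (continuous_of_is_derive _ _ (2 * (W y - W c))).
      auto_derive; [exact I|ring].
    - intros y Hy.
      replace (2 * (W y - W c) * (A - f (W y)))
        with ((A - f (W y)) * (2 * (W y - W c))) by ring.
      apply (is_derive_comp (fun s => (s - W c) ^ 2) W); [|apply Hd, Hy].
      auto_derive; [exact I|ring].
    - intros y; apply pow2_ge_0.
    - intros y Hy.
      assert (L := flux_lipschitz M (W c) (W y) (HM c Hcr) (HM y ltac:(lra))).
      fold K in L; rewrite HA in L.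
      rewrite Rabs_mult, Rabs_mult, (Rabs_right 2) by lra.
      rewrite (Rabs_minus_sym (W c)) in L.
      assert (P := Rabs_pos (W y - W c)).
      rewrite <- pow2_abs.
      nra.
    - ring. }
  nra.
Qed.

(** [f W - A] has no zero, since otherwise [W] would be constant; it is positive where [W] has its
    mean slope [(u0 - u1) / T], hence everywhere. At [T] this bounds [A], and it makes [W] decrease
    to [u0]. *)
Lemma viscous_profile_bounds (W : R -> R) (A T u0 u1 : R) :
  0 < T -> u0 < u1 -> (forall x, continuous W x) ->
  (forall x, 0 < x < T -> is_derive W x (A - f (W x))) ->
  W 0 = u1 -> W T = u0 ->
  A < f u0 /\ forall x, 0 <= x <= T -> u0 <= W x.
Proof.
  intros HT Hu Hc Hd H0 H1.
  assert (Hpos : forall x, 0 <= x <= T -> 0 < f (W x) - A).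
  { destruct (mean_value_open W _ 0 T HT Hc Hd) as [c [Hcr E]].
    apply (positive_of_nonvanishing (fun x => f (W x) - A) T c); [| |lra|nra].
    - intros x; apply (continuous_minus (fun x => f (W x)) (fun _ => A)).
      + apply (continuous_comp W f); [apply Hc|apply flux_continuous].
      + apply continuous_const.
    - intros x Hx E0.
      assert (E1 := equilibrium_unique W A T x Hc Hd Hx ltac:(lra)).
      assert (W 0 = W x) by (apply E1; lra).
      assert (W T = W x) by (apply E1; lra).
      lra. }
  split.
  - specialize (Hpos T ltac:(lra)); rewrite H1 in Hpos; lra.
  - intros x Hx; rewrite <- H1.
    apply (nonincreasing_of_derive W (fun x => A - f (W x)) x T); [lra|exact Hc| |].
    + intros y Hy; apply Hd; lra.
    + intros y Hy; specialize (Hpos y ltac:(lra)); lra.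
Qed.

(** [u0] is an equilibrium: a profile reaching it would be constant and could not start at [u1]. *)
Lemma layer_profile_bounds (V : R -> R) (T u0 u1 : R) :
  u0 < u1 -> (forall x, continuous V x) ->
  (forall x, 0 < x < T -> is_derive V x (f u0 - f (V x))) -> V 0 = u1 ->
  forall x, 0 <= x <= T -> u0 <= V x.
Proof.
  intros Hu Hc Hd H0 x Hx.
  assert (0 < V x - u0); [|lra].
  apply (positive_of_nonvanishing (fun x => V x - u0) T 0); [| |lra|lra|exact Hx].
  - intros y; apply (continuous_minus V (fun _ => u0)); [apply Hc|apply continuous_const].
  - intros y Hy E.
    assert (Ey : V y = u0) by lra.
    assert (V 0 = V y); [|lra].
    apply (equilibrium_unique V (f u0) T); auto; [rewrite Ey; reflexivity|lra].
Qed.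

Lemma flux_increment_ge (u0 x y : R) :
  u0 <= x -> x <= y -> Derive f u0 * (y - x) <= f y - f x.
Proof.
  intros H1 H2.
  assert (A := convex_tangent_le f x y (hder x) hconv).
  assert (B := derive_flux_le u0 x H1).
  nra.
Qed.

(** [D = V - W] satisfies [D' = d - (f V - f W)], and above [u0] increments of [f] are at least
    [a = Derive f u0 >= 0] times those of its argument. Sign comparison is applied in turn to [-D],
    [D - d x] and [a D - d]. The second bound serves the case [a = 0], the third the case
    [a > 0]. *)
Lemma profile_difference (V W : R -> R) (T u0 u1 d : R) :
  0 <= Derive f u0 -> 0 <= d -> u0 < u1 ->
  (forall x, continuous V x) -> (forall x, continuous W x) ->
  (forall x, 0 < x < T -> is_derive V x (f u0 - f (V x))) ->
  (forall x, 0 < x < T -> is_derive W x (f u0 - d - f (W x))) ->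
  V 0 = u1 -> W 0 = u1 -> (forall x, 0 <= x <= T -> u0 <= W x) ->
  forall x, 0 <= x <= T ->
    0 <= V x - W x /\ V x - W x <= d * x /\ Derive f u0 * (V x - W x) <= d.
Proof.
  intros Ha Hd Hu HcV HcW HdV HdW HV0 HW0 HW.
  assert (HV := layer_profile_bounds V T u0 u1 Hu HcV HdV HV0).
  set (a := Derive f u0) in *.
  assert (HcD : forall x, continuous (fun y => V y - W y) x)
    by (intros x; apply (continuous_minus V W); auto).
  assert (HdD : forall x, 0 < x < T ->
    is_derive (fun y => V y - W y) x (d - (f (V x) - f (W x)))).
  { intros x Hx.
    replace (d - (f (V x) - f (W x)))
      with ((f u0 - f (V x)) - (f u0 - d - f (W x))) by ring.
    apply (is_derive_minus V W); auto. }
  assert (Hge : forall x, 0 < x < T -> 0 < V x - W x ->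
    a * (V x - W x) <= f (V x) - f (W x)).
  { intros x Hx HD; apply flux_increment_ge; [apply HW|]; lra. }
  intros x Hx; repeat split.
  - assert (W x - V x <= 0); [|lra].
    apply (nonpositive_of_derive (fun y => W y - V y)
             (fun y => (f (V y) - f (W y)) - d) T); [| |lra| |exact Hx].
    + intros y; apply (continuous_minus W V); auto.
    + intros y Hy.
      replace (f (V y) - f (W y) - d)
        with ((f u0 - d - f (W y)) - (f u0 - f (V y))) by ring.
      apply (is_derive_minus W V); auto.
    + intros y Hy HE.
      assert (L := flux_increment_ge u0 (V y) (W y) (HV y ltac:(lra)) ltac:(lra)).
      fold a in L; nra.
  - assert (V x - W x - d * x <= 0); [|lra].
    apply (nonpositive_of_derive (fun y => V y - W y - d * y)
             (fun y => d - (f (V y) - f (W y)) - d) T); [| |lra| |exact Hx].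
    + intros y; apply (continuous_minus (fun y => V y - W y) (fun y => d * y)).
      * apply HcD.
      * apply (continuous_of_is_derive _ _ d); auto_derive; [exact I|ring].
    + intros y Hy; apply (is_derive_minus (fun y => V y - W y) (fun y => d * y)).
      * apply HdD, Hy.
      * auto_derive; [exact I|ring].
    + intros y Hy HE; assert (0 < V y - W y) by nra.
      assert (L := Hge y Hy ltac:(lra)); nra.
  - assert (a * (V x - W x) - d <= 0); [|lra].
    apply (nonpositive_of_derive (fun y => a * (V y - W y) - d)
             (fun y => a * (d - (f (V y) - f (W y)))) T); [| |nra| |exact Hx].
    + intros y; apply (continuous_comp (fun y => V y - W y) (fun s => a * s - d));
        [apply HcD|].
      apply (continuous_of_is_derive _ _ a); auto_derive; [exact I|ring].
    + intros y Hy.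
      replace (a * (d - (f (V y) - f (W y))))
        with ((d - (f (V y) - f (W y))) * a) by ring.
      apply (is_derive_comp (fun s => a * s - d) (fun y => V y - W y));
        [|apply HdD, Hy].
      auto_derive; [exact I|ring].
    + intros y Hy HE.
      assert (0 < V y - W y) by nra.
      assert (L := Hge y Hy ltac:(lra)); nra.
Qed.

(** * Size of the defect in terms of the length of the interval *)

(** As [f] lies above its tangent at [u0], [S = a (W - u0) + d] satisfies [S' <= - a S], so
    [S exp(a x)] is nonincreasing; its values at 0 and [T] are compared. *)
Lemma defect_exponential_bound (W : R -> R) (T u0 u1 d : R) :
  0 < T -> 0 < Derive f u0 -> (forall x, continuous W x) ->
  (forall x, 0 < x < T -> is_derive W x (f u0 - d - f (W x))) ->
  W 0 = u1 -> W T = u0 ->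
  d * (exp (Derive f u0 * T) - 1) <= Derive f u0 * (u1 - u0).
Proof.
  intros HT Ha Hc Hd H0 H1; set (a := Derive f u0) in *.
  assert (E : (a * (W T - u0) + d) * exp (a * T)
              <= (a * (W 0 - u0) + d) * exp (a * 0)).
  { apply (nonincreasing_of_derive (fun x => (a * (W x - u0) + d) * exp (a * x))
      (fun x => (a * (f u0 - d - f (W x)) + a * (a * (W x - u0) + d))
                  * exp (a * x))); [lra| | |].
    - intros x.
      apply (continuous_mult (fun x => a * (W x - u0) + d) (fun x => exp (a * x))).
      + apply (continuous_comp W (fun s => a * (s - u0) + d)); [apply Hc|].
        apply (continuous_of_is_derive _ _ a); auto_derive; [exact I|ring].
      + apply (continuous_of_is_derive _ _ (a * exp (a * x))).
        auto_derive; [exact I|ring].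
    - intros x Hx; specialize (Hd x Hx).
      auto_derive; [exists (f u0 - d - f (W x)); exact Hd|].
      replace (Derive (fun x0 => W x0) x) with (f u0 - d - f (W x))
        by (symmetry; apply is_derive_unique, Hd).
      ring.
    - intros x Hx.
      assert (L := convex_tangent_le f u0 (W x) (hder u0) hconv); fold a in L.
      assert (P := exp_pos (a * x)).
      assert (a * (f u0 - d - f (W x)) + a * (a * (W x - u0) + d) <= 0) by nra.
      nra. }
  rewrite H0, H1, Rmult_0_r, exp_0 in E; nra.
Qed.

(** The Riccati inequality [W' <= - d - k W^2] is integrated by an arctangent: with
    [s = sqrt (k * d)], [atan (k W / s) + s x] is nonincreasing, and boundedness of the arctangent
    limits [s * T]. *)
Lemma defect_quadratic_bound (W : R -> R) (T u1 d k : R) :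
  0 < T -> 0 < d -> 0 < k -> (forall x, continuous W x) ->
  (forall x, 0 < x < T -> is_derive W x (- d - f (W x))) ->
  (forall x, 0 < x < T -> k * W x ^ 2 <= f (W x)) ->
  W 0 = u1 -> W T = 0 ->
  k * d * T ^ 2 <= 4.
Proof.
  intros HT Hd0 Hk Hc Hd Hq H0 H1.
  assert (Hkd : 0 < k * d) by (apply Rmult_lt_0_compat; assumption).
  set (s := sqrt (k * d)).
  assert (Hs : 0 < s) by (apply sqrt_lt_R0, Hkd).
  assert (Hss : s * s = k * d) by (apply sqrt_sqrt; lra).
  clearbody s.
  assert (E : atan (k / s * W T) + s * T <= atan (k / s * W 0) + s * 0).
  { apply (nonincreasing_of_derive (fun x => atan (k / s * W x) + s * x)
      (fun x => k / s * (- d - f (W x)) / (1 + (k / s * W x) ^ 2) + s)); [lra| | |].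
    - intros x; apply (continuous_plus (fun x => atan (k / s * W x)) (fun x => s * x)).
      + apply (continuous_comp W (fun z => atan (k / s * z))); [apply Hc|].
        apply (continuous_of_is_derive _ _ (k / s / (1 + (k / s * W x) ^ 2))).
        auto_derive; [exact I|]. field; split; [lra|apply Rgt_not_eq; nra].
      + apply (continuous_of_is_derive _ _ s); auto_derive; [exact I|ring].
    - intros x Hx; specialize (Hd x Hx).
      auto_derive; [exists (- d - f (W x)); exact Hd|].
      replace (Derive (fun x0 => W x0) x) with (- d - f (W x))
        by (symmetry; apply is_derive_unique, Hd).
      field; split; [lra|apply Rgt_not_eq; nra].
    - intros x Hx; specialize (Hq x Hx).
      assert (Q : 0 < s * s + (k * W x) ^ 2) by nra.
      (* Since [s * s = k * d], the derivative has the sign of [k W^2 - f W]. *)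
      replace (k / s * (- d - f (W x)) / (1 + (k / s * W x) ^ 2) + s)
        with (s * k * (k * W x ^ 2 - f (W x)) / (s * s + (k * W x) ^ 2)).
      + apply Rmult_le_reg_r with (1 := Q).
        unfold Rdiv; rewrite Rmult_assoc, Rinv_l, Rmult_1_r, Rmult_0_l by lra.
        assert (0 < s * k) by nra; nra.
      + replace d with (s * s / k) by (rewrite Hss; field; lra).
        field; repeat split; apply Rgt_not_eq; nra. }
  (* [s * T < PI / 2 <= 2]; the constant 4 is the square of this bound. *)
  assert (P := PI_4); assert (B := atan_bound (k / s * W 0)).
  rewrite H1, Rmult_0_r, atan_0 in E.
  assert (s * T <= 2) by lra.
  assert (0 < s * T) by nra.
  rewrite <- Hss; nra.
Qed.

(** [f' >= 0] on the half-line forces [q > 0], so [f' x >= (q / 2) x] near 0, which integrates to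
    [f u >= (q / 4) u^2] there. Farther out [f] is nondecreasing, and a smaller constant works up to
    [u1]. *)
Lemma flux_quadratic_lower_bound (u1 : R) :
  f 0 = 0 -> Derive f 0 = 0 -> ex_derive (Derive f) 0 ->
  Derive (Derive f) 0 <> 0 -> 0 < u1 ->
  exists k, 0 < k /\ forall u, 0 <= u <= u1 -> k * u ^ 2 <= f u.
Proof.
  intros h0 h0' hd hne Hu; set (q := Derive (Derive f) 0) in *.
  assert (Hnn : forall x, 0 <= x -> 0 <= Derive f x)
    by (intros x Hx; rewrite <- h0'; apply derive_flux_le, Hx).
  assert (D : derivable_pt_lim (Derive f) 0 q)
    by (apply is_derive_Reals, Derive_correct, hd).
  assert (Hq2 : 0 < Rabs q / 2) by (assert (P := Rabs_pos_lt q hne); lra).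
  destruct (D _ Hq2) as [[r Hr] Hlim]; simpl in Hlim.
  assert (Hslope : forall x, 0 < x < r -> Rabs (Derive f x / x - q) < Rabs q / 2).
  { intros x Hx; specialize (Hlim x ltac:(lra)).
    rewrite Rplus_0_l, h0', Rminus_0_r in Hlim; apply Hlim.
    rewrite Rabs_right; lra. }
  assert (Hquot : forall x, 0 < x -> 0 <= Derive f x / x).
  { intros x Hx; apply Rmult_le_pos; [apply Hnn; lra|].
    apply Rlt_le, Rinv_0_lt_compat, Hx. }
  assert (Hq : 0 < q).
  { assert (S := Hslope (r / 2) ltac:(lra)).
    assert (S' := Hquot (r / 2) ltac:(lra)).
    apply Rabs_lt_between in S; revert S; unfold Rabs; destruct (Rcase_abs q); lra. }
  set (eta := Rmin (r / 2) u1).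
  assert (He0 : 0 < eta) by (apply Rmin_pos; lra).
  assert (Her : eta <= r / 2) by apply Rmin_l.
  assert (Heu : eta <= u1) by apply Rmin_r.
  assert (Hsmall : forall u, 0 <= u <= eta -> q / 4 * u ^ 2 <= f u).
  { intros u Hu'.
    assert (E : q / 4 * u ^ 2 - f u <= q / 4 * 0 ^ 2 - f 0); [|lra].
    apply (nonincreasing_of_derive (fun u => q / 4 * u ^ 2 - f u)
             (fun u => q / 2 * u - Derive f u)); [lra| | |].
    - intros x; apply (continuous_minus (fun u => q / 4 * u ^ 2) f);
        [|apply flux_continuous].
      apply (continuous_of_is_derive _ _ (q / 2 * x)); auto_derive; [exact I|field].
    - intros x _; apply (is_derive_minus (fun u => q / 4 * u ^ 2) f).
      + auto_derive; [exact I|field].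
      + apply Derive_correct, hder.
    - intros x Hx; assert (S := Hslope x ltac:(lra)).
      rewrite (Rabs_right q) in S by lra; apply Rabs_lt_between in S.
      replace (Derive f x) with (Derive f x / x * x) by (field; lra).
      nra. }
  (* The factor [(eta / u1)^2] shrinks [[0, u1]] to [[0, eta]], so that
     [k u^2 <= (q / 4) eta^2 <= f eta <= f u] for [u] beyond [eta]. *)
  set (k := q / 4 * (eta / u1) ^ 2).
  assert (Hr0 : 0 < eta / u1) by (apply Rdiv_lt_0_compat; lra).
  assert (Hr1 : eta / u1 <= 1).
  { apply Rmult_le_reg_r with u1; [lra|].
    unfold Rdiv; rewrite Rmult_assoc, Rinv_l; lra. }
  set (m := eta / u1) in *.
  assert (Hm0 : 0 < m ^ 2) by (apply pow_lt, Hr0).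
  assert (Hm1 : m ^ 2 <= 1) by nra.
  exists k; split; [unfold k; nra|].
  intros u Hu'; destruct (Rle_dec u eta) as [L|L].
  - apply Rle_trans with (2 := Hsmall u ltac:(lra)).
    apply Rmult_le_compat_r; [apply pow2_ge_0|]; unfold k; nra.
  - assert (M := convex_tangent_le f eta u (hder eta) hconv).
    assert (N := Hnn eta ltac:(lra)); assert (S := Hsmall eta ltac:(lra)).
    apply Rle_trans with (q / 4 * eta ^ 2); [|nra].
    replace (k * u ^ 2) with (q / 4 * (m * u) ^ 2) by (unfold k; ring).
    assert (m * u <= eta).
    { replace eta with (m * u1) by (unfold m; field; lra).
      apply Rmult_le_compat_l; lra. }
    apply Rmult_le_compat_l; [lra|].
    apply pow_incr; nra.
Qed.

End convex_flux.

(** * Reduction of the second-order problems to first-order equations *)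

(** [e u' - F u] has zero derivative on [P]. The predicate [P] stands for an interval, so that
    [(0, 1)] and the open half-line are treated at once. *)
Lemma first_integral (F : R -> R) (u : R -> R) (e : R) (P : R -> Prop) (p : R) :
  (forall s, ex_derive F s) -> P p ->
  (forall x y z, P x -> P y -> x <= z <= y -> P z) ->
  (forall x, P x -> twice_derivable_at u x /\
     e * Derive_n u 2 x = Derive (fun y => F (u y)) x) ->
  exists A, forall x, P x -> e * Derive u x = F (u x) - A.
Proof.
  intros HF Hp Hconn Hode.
  exists (F (u p) - e * Derive u p); intros x Hx.
  assert (E : e * Derive u x - F (u x) = e * Derive u p - F (u p)); [|lra].
  apply (null_derive_eq (fun y => e * Derive u y - F (u y))).
  intros y Hy.
  assert (Py : P y).
  { revert Hy; unfold Rmin, Rmax; destruct (Rle_dec x p); intros Hy;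
      [apply (Hconn x p)|apply (Hconn p x)]; assumption. }
  destruct (Hode y Py) as [[D1 D2] Ey].
  replace 0 with (e * Derive_n u 2 y - Derive (fun y => F (u y)) y) by lra.
  apply (is_derive_minus (fun y => e * Derive u y) (fun y => F (u y))).
  - apply (is_derive_scal (Derive u)), Derive_correct, D2.
  - apply Derive_correct, (ex_derive_comp F u); [apply HF|exact D1].
Qed.

(** Turns continuity relative to a closed domain into continuity on the line; [c] will be built from
    a projection onto the domain. *)
Lemma continuous_comp_on (D : R -> Prop) (u c : R -> R) (x : R) :
  continuous_on D u -> continuous c x -> (forall y, D (c y)) ->
  continuous (fun y => u (c y)) x.
Proof.
  intros Hu Hc HD P HP.
  assert (L := Hc _ (Hu (c x) (HD x) P HP)); unfold filtermap in L.
  unfold filtermap; revert L; apply filter_imp; intros y Hy; apply Hy, HD.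
Qed.

Lemma continuous_of_lipschitz1 (c : R -> R) (x : R) :
  (forall y, Rabs (c y - c x) <= Rabs (y - x)) -> continuous c x.
Proof.
  intros H; apply filterlim_locally; intros e.
  exists e; intros y Hy; exact (Rle_lt_trans _ _ _ (H y) Hy).
Qed.

(** The first integral reads [eps u' = f u - A]; reversing and stretching the variable gives
    [W' = A - f W] started at [u1], with defect [d = f u0 - A]. *)
Lemma viscous_profile (f : R -> R) (eps u0 u1 : R) (u : R -> R) :
  (forall x, ex_derive f x) -> strictly_convex f -> 0 < eps -> u0 < u1 ->
  viscous_bvp_solution f eps u0 u1 u ->
  exists (d : R) (W : R -> R),
    0 < d /\ (forall x, continuous W x) /\
    (forall x, 0 < x < / eps -> is_derive W x (f u0 - d - f (W x))) /\
    W 0 = u1 /\ W (/ eps) = u0 /\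
    (forall x, 0 <= x <= / eps -> u0 <= W x) /\
    (forall x, 0 <= x <= 1 -> u x = W ((1 - x) / eps)).
Proof.
  intros hder hconv He Hu (Hc & Hode & H0 & H1).
  destruct (first_integral f u eps (fun x => 0 < x < 1) (1/2)) as [A HA];
    [exact hder|lra|intros; lra|exact Hode|].
  (* Projection onto [[0, 1]]: it extends [W] to the line by its end values. *)
  set (c := fun z => Rmax 0 (Rmin 1 z)).
  assert (Hcid : forall z, 0 <= z <= 1 -> c z = z)
    by (intros z Hz; unfold c; rewrite Rmin_right, Rmax_right; lra).
  set (W := fun y => u (c (1 - eps * y))).
  assert (HT : 0 < / eps) by (apply Rinv_0_lt_compat, He).
  assert (HeT : eps * / eps = 1) by (apply Rinv_r; lra).
  assert (HcW : forall y, continuous W y).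
  { intros y; apply (continuous_comp_on (fun x => 0 <= x <= 1) u); [exact Hc| |].
    - apply (continuous_comp (fun y => 1 - eps * y) c).
      + apply (continuous_of_is_derive _ _ (- eps)); auto_derive; [exact I|ring].
      + apply continuous_of_lipschitz1; intros z; unfold c, Rmax, Rmin.
        repeat destruct Rle_dec; unfold Rabs; repeat destruct Rcase_abs; lra.
    - intros z; unfold c, Rmax, Rmin; repeat destruct Rle_dec; lra. }
  assert (HdW : forall y, 0 < y < / eps -> is_derive W y (A - f (W y))).
  { intros y Hy.
    assert (Hin : 0 < 1 - eps * y < 1) by nra.
    assert (EW : W y = u (1 - eps * y)) by (unfold W; rewrite Hcid; lra).
    apply (is_derive_ext_loc (fun y => u (1 - eps * y))).
    - assert (Ho : locally y (fun z => 0 < z < / eps)).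
      { apply (open_and (fun z => 0 < z) (fun z => z < / eps));
          [apply open_gt|apply open_lt|exact Hy]. }
      apply filter_imp with (2 := Ho); intros z Hz.
      unfold W; rewrite Hcid; [reflexivity|nra].
    - rewrite EW.
      replace (A - f (u (1 - eps * y))) with (- eps * Derive u (1 - eps * y))
        by (specialize (HA _ Hin); lra).
      apply (is_derive_comp u (fun y => 1 - eps * y)).
      + apply Derive_correct, (Hode _ Hin).
      + auto_derive; [exact I|ring]. }
  assert (W0 : W 0 = u1) by (unfold W; rewrite Hcid; [rewrite <- H1; f_equal|]; lra).
  assert (WT : W (/ eps) = u0)
    by (unfold W; rewrite HeT, Hcid; [rewrite <- H0; f_equal|]; lra).
  destruct (viscous_profile_bounds f hder hconv W A (/ eps) u0 u1)
    as [HAu HW]; try assumption.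
  exists (f u0 - A), W.
  refine (conj _ (conj HcW (conj _ (conj W0 (conj WT (conj HW _)))))); [lra| |].
  - intros y Hy; replace (f u0 - (f u0 - A)) with A by ring; apply HdW, Hy.
  - intros x Hx; unfold W.
    replace (1 - eps * ((1 - x) / eps)) with x by (field; lra).
    rewrite Hcid; [reflexivity|exact Hx].
Qed.

(** The first integral, taken with [e = -1] and the shifted flux [f (u0 + s)], gives [V' = B - f V];
    the limit at infinity identifies [B]. *)
Lemma layer_profile (f : R -> R) (u0 u1 : R) (v : R -> R) :
  (forall x, ex_derive f x) -> layer_solution f u0 u1 v ->
  exists V : R -> R,
    (forall x, continuous V x) /\
    (forall x, 0 < x -> is_derive V x (f u0 - f (V x))) /\
    V 0 = u1 /\ (forall x, 0 <= x -> V x = u0 + v x).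
Proof.
  intros hder (Hc & Hode & H0 & Hlim).
  destruct (first_integral (fun s => f (u0 + s)) v (-1) (fun x => 0 < x) 1)
    as [B HB]; [|lra|intros; lra| |].
  - intros s; apply (ex_derive_comp f (fun s => u0 + s)); [apply hder|].
    auto_derive; exact I.
  - intros x Hx; destruct (Hode x Hx) as [D E]; split; [exact D|].
    rewrite E; ring.
  - set (V := fun y => u0 + v (Rmax 0 y)).
    assert (HVid : forall x, 0 <= x -> V x = u0 + v x)
      by (intros x Hx; unfold V; rewrite Rmax_right; auto).
    assert (HcV : forall y, continuous V y).
    { intros y; apply (continuous_plus (fun _ => u0) (fun y => v (Rmax 0 y)));
        [apply continuous_const|].
      apply (continuous_comp_on (fun y => 0 <= y) v); [exact Hc| |].
      - apply continuous_of_lipschitz1; intros z; unfold Rmax.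
        repeat destruct Rle_dec; unfold Rabs; repeat destruct Rcase_abs; lra.
      - intros z; apply Rmax_l. }
    assert (HdV : forall y, 0 < y -> is_derive V y (B - f (V y))).
    { intros y Hy; apply (is_derive_ext_loc (fun y => u0 + v y)).
      - apply filter_imp with (2 := open_gt 0 y Hy); intros z Hz.
        symmetry; apply HVid; lra.
      - rewrite HVid by lra; specialize (HB y Hy); simpl in HB.
        replace (B - f (u0 + v y)) with (0 + Derive v y) by lra.
        apply (is_derive_plus (fun _ => u0) v); [apply (is_derive_const u0 y)|].
        apply Derive_correct, (Hode y Hy). }
    (* [V'] tends to [B - f u0], which must vanish since [V] converges. *)
    assert (HBu : B = f u0).
    { destruct (Req_dec B (f u0)) as [|Hne]; [assumption|exfalso].
      assert (Hl : 0 < Rabs (B - f u0)) by (apply Rabs_pos_lt; lra).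
      set (l := Rabs (B - f u0)) in *.
      assert (Hf := flux_continuous f hder u0).
      apply filterlim_locally with (eps := mkposreal (l / 2) ltac:(lra)) in Hf.
      destruct Hf as [[r Hr] Hf].
      (* With margin [l / 8], [V] varies by less than [l / 4] over a unit interval far out, where
         its slope exceeds [l / 2] in absolute value. *)
      assert (Hm : 0 < Rmin r (l / 8)) by (apply Rmin_pos; lra).
      apply is_lim_spec in Hlim; destruct (Hlim (mkposreal _ Hm)) as [M HM].
      simpl in HM.
      set (p := Rmax 0 M + 1).
      assert (Hp0 : 0 < p) by (assert (Q := Rmax_l 0 M); unfold p; lra).
      assert (HpM : M < p) by (assert (Q := Rmax_r 0 M); unfold p; lra).
      assert (Hclose : forall y, p <= y -> Rabs (V y - u0) < Rmin r (l / 8)).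
      { intros y Hy; rewrite HVid by lra.
        replace (u0 + v y - u0) with (v y - 0) by ring; apply HM; lra. }
      destruct (mean_value_open V (fun y => B - f (V y)) p (p + 1))
        as [z [Hz E]]; [lra|exact HcV|intros; apply HdV; lra|].
      assert (C1 := Hclose p ltac:(lra)); assert (C2 := Hclose (p + 1) ltac:(lra)).
      assert (C3 := Hclose z ltac:(lra)).
      assert (Hfz : Rabs (f (V z) - f u0) < l / 2)
        by (apply (Hf (V z)), Rlt_le_trans with (1 := C3), Rmin_l).
      assert (Q := Rmin_r r (l / 8)).
      apply Rabs_lt_between in C1, C2, Hfz.
      replace (p + 1 - p) with 1 in E by ring.
      clear Hf; revert Hl E C1 C2 Hfz Q.
      generalize (Rmin r (l / 8)); unfold l, Rabs; destruct (Rcase_abs (B - f u0));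
        intros; lra. }
    exists V; refine (conj HcV (conj _ (conj _ HVid))).
    + rewrite <- HBu; exact HdV.
    + rewrite HVid, H0; lra.
Qed.

(** * Error estimates with constants independent of [eps] *)

Theorem theorem3p10 (f : R -> R) (u0 u1 : R) (uh : R -> R -> R) (v : R -> R)
    (hC2 : class_C2 f) (hconv : strictly_convex f)
    (hf0 : f 0 = 0) (hf'0 : Derive f 0 = 0)
    (hu0 : 0 <= u0) (hu01 : u0 < u1)
    (huh : forall eps : R, 0 < eps <= 1 ->
             viscous_bvp_solution f eps u0 u1 (uh eps))
    (hv : layer_solution f u0 u1 v) :
  exists C : R, 0 < C /\
    forall eps : R, 0 < eps <= 1 ->
    forall x : R, 0 <= x <= 1 ->
      (0 < u0 ->
         Rabs (uh eps x - u0 - v ((1 - x) / eps))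
           <= C * exp (- Derive f u0 / eps)) /\
      (u0 = 0 -> Derive_n f 2 0 <> 0 ->
         Rabs (uh eps x - v ((1 - x) / eps)) <= C * eps).
Proof.
  assert (hder : forall x, ex_derive f x) by (intros x; apply (hC2 x)).
  destruct (layer_profile f u0 u1 v hder hv) as (V & HcV & HdV & HV0 & HVv).
  set (a := Derive f u0).
  assert (Ha : 0 <= a) by (unfold a; rewrite <- hf'0; apply derive_flux_le; auto).
  (* Shared by both regimes: the error is at most [d / eps], and [a] times the error at most [d].
     Only the size of [d] remains to be found. *)
  assert (Hdiff : forall eps, 0 < eps <= 1 -> exists (d : R) (W : R -> R),
    0 < d /\ (forall x, continuous W x) /\
    (forall x, 0 < x < / eps -> is_derive W x (f u0 - d - f (W x))) /\
    W 0 = u1 /\ W (/ eps) = u0 /\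
    (forall x, 0 <= x <= / eps -> u0 <= W x <= u1) /\
    forall x, 0 <= x <= 1 ->
      Rabs (uh eps x - u0 - v ((1 - x) / eps)) <= d * / eps /\
      a * Rabs (uh eps x - u0 - v ((1 - x) / eps)) <= d).
  { intros eps He.
    destruct (viscous_profile f eps u0 u1 (uh eps) hder hconv ltac:(lra) hu01
                (huh eps He)) as (d & W & Hd & HcW & HdW & HW0 & HWT & HW & HWu).
    assert (HT : 0 < / eps) by (apply Rinv_0_lt_compat; lra).
    assert (bound : forall x, 0 <= x <= 1 ->
      Rabs (uh eps x - u0 - v ((1 - x) / eps)) <= d * / eps /\
      a * Rabs (uh eps x - u0 - v ((1 - x) / eps)) <= d).
    { intros x Hx; set (y := (1 - x) / eps).
      assert (Hy : 0 <= y <= / eps) by (unfold y, Rdiv; nra).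
      destruct (profile_difference f hder hconv V W (/ eps) u0 u1 d Ha
                  ltac:(lra) hu01 HcV HcW ltac:(intros; apply HdV; lra)
                  HdW HV0 HW0 HW y Hy) as (P1 & P2 & P3).
      rewrite (HWu x Hx); fold y.
      replace (W y - u0 - v y) with (- (V y - W y))
        by (rewrite HVv by lra; ring).
      rewrite Rabs_Ropp, Rabs_right by lra; split; [nra|exact P3]. }
    exists d, W.
    refine (conj Hd (conj HcW (conj HdW (conj HW0 (conj HWT (conj _ bound)))))).
    intros x Hx; split; [apply HW, Hx|].
    (* [W] decreases from [u1], because [f W >= f u0] as long as [W >= u0]. *)
    - rewrite <- HW0.
      apply (nonincreasing_of_derive W (fun x => f u0 - d - f (W x)));
        [lra|exact HcW|intros y Hy; apply HdW; lra|].
      intros y Hy; assert (L := HW y ltac:(lra)).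
      assert (M := flux_increment_ge f hder hconv u0 u0 (W y) ltac:(lra) L).
      fold a in M; nra. }
  destruct (Rle_lt_or_eq_dec 0 u0 hu0) as [Hpos | Hzero].
  (* Strict convexity at the midpoint gives [f u0 > 2 f (u0 / 2) >= 0], and the tangent at [u0]
     evaluated at 0 gives [a * u0 >= f u0]. *)
  - assert (Ha0 : 0 < a).
    { assert (S := hconv u0 0 (1/2) ltac:(lra) ltac:(lra)).
      assert (N := convex_tangent_le f 0 (1/2 * u0 + (1 - 1/2) * 0) (hder 0) hconv).
      assert (L := convex_tangent_le f u0 0 (hder u0) hconv); fold a in L.
      rewrite hf0, hf'0 in *; nra. }
    assert (Hea : 0 < 1 - exp (- a)).
    { assert (exp (- a) < exp 0) by (apply exp_increasing; lra).
      rewrite exp_0 in *; lra. }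
    (* For [eps <= 1], [exp (a / eps) - 1 >= (1 - exp (- a)) exp (a / eps)]; the exponential bound
       thus becomes [d <= a C exp (- a / eps)], and [a] cancels against the error estimate. *)
    exists ((u1 - u0) / (1 - exp (- a))).
    split; [apply Rdiv_lt_0_compat; lra|].
    intros eps He x Hx; split; [intros _|lra].
    destruct (Hdiff eps He) as (d & W & Hd & HcW & HdW & HW0 & HWT & HW & Hb).
    destruct (Hb x Hx) as [_ Hb2].
    set (D := Rabs (uh eps x - u0 - v ((1 - x) / eps))) in *.
    assert (HT1 : 1 <= / eps)
      by (rewrite <- Rinv_1; apply Rinv_le_contravar; lra).
    assert (Hdexp := defect_exponential_bound f hder hconv W (/ eps) u0 u1 d
                       ltac:(lra) Ha0 HcW HdW HW0 HWT).
    fold a in Hdexp.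
    assert (E0 := exp_pos (a * / eps)).
    assert (HE : exp (a * / eps) * (1 - exp (- a)) <= exp (a * / eps) - 1).
    { rewrite Rmult_minus_distr_l, <- exp_plus.
      assert (1 <= exp (a * / eps + - a)); [|lra].
      assert (L := exp_ineq1_le (a * / eps + - a)); nra. }
    replace (- a / eps) with (- (a * / eps)) by (unfold Rdiv; ring).
    rewrite (exp_Ropp (a * / eps)).
    set (E := exp (a * / eps)) in *; set (q := 1 - exp (- a)) in *.
    apply Rmult_le_reg_r with (a * (E * q)); [apply Rmult_lt_0_compat; nra|].
    replace ((u1 - u0) / q * / E * (a * (E * q))) with (a * (u1 - u0))
      by (field; lra).
    apply Rle_trans with (2 := Hdexp).
    apply Rle_trans with (d * (E * q)); [|nra].
    replace (D * (a * (E * q))) with (a * D * (E * q)) by ring.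
    apply Rmult_le_compat_r; nra.
  - symmetry in Hzero; subst u0.
    destruct (Req_dec (Derive_n f 2 0) 0) as [Hz | Hnz].
    (* Both implications are vacuous here, so any positive constant will do. *)
    { exists 1; split; [lra|]; intros; split; [lra|].
      intros _ Hnz; contradiction. }
    destruct (flux_quadratic_lower_bound f hder hconv u1 hf0 hf'0)
      as (k & Hk & Hq); [apply (hC2 0)|exact Hnz|lra|].
    (* Combines [k * d / eps^2 <= 4] with an error of at most [d / eps]. *)
    exists (4 / k); split; [apply Rdiv_lt_0_compat; lra|].
    intros eps He x Hx; split; [lra|intros _ _].
    destruct (Hdiff eps He) as (d & W & Hd & HcW & HdW & HW0 & HWT & HW & Hb).
    destruct (Hb x Hx) as [Hb1 _]; rewrite Rminus_0_r in Hb1.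
    apply Rle_trans with (1 := Hb1).
    assert (HT : 0 < / eps) by (apply Rinv_0_lt_compat; lra).
    assert (Hdq : k * d * (/ eps) ^ 2 <= 4).
    { apply (defect_quadratic_bound f W (/ eps) u1 d k); auto.
      - intros y Hy; replace (- d - f (W y)) with (f 0 - d - f (W y))
          by (rewrite hf0; ring).
        apply HdW, Hy.
      - intros y Hy; apply Hq, HW; lra. }
    apply Rmult_le_reg_r with (k * / eps); [nra|].
    replace (4 / k * eps * (k * / eps)) with 4 by (field; lra).
    nra.
Qed.
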